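(* Let $R$ be a commutative unital ring, let $A$ and $B$ be unital associative $R$-algebras and let $M$ be a nonzero $(A,B)$-bimodule that is faithful as a left $A$-module and as a right $B$-module. Let $\mathcal{T}=\mathrm{Trian}(A,M,B)$ be the associated triangular algebra and $\sigma$ an automorphism of $\mathcal{T}$. Assume that $A$ and $B$ have only trivial idempotents, and let $f_\sigma, g_\sigma, m_\sigma, \nu_\sigma$ be the data determined by $\sigma$. Let $D$ be a generalized $\sigma$-derivation of $\mathcal{T}$. Then there exist an $f_\sigma$-derivation $d_A$ of $A$, a $g_\sigma$-derivation $d_B$ of $B$, and a linear map $\xi:M\to M$ such that $$\xi(am)=d_A(a)m+f_\sigma(a)\xi(m),\qquad \xi(mb)=\xi(m)b+\nu_\sigma(m)d_B(b)$$ for all $a\in A$, $b\in B$, $m\in M$, and which satisfy $$D\begin{pmatrix} a & m\\ & b\end{pmatrix}=\begin{pmatrix} D_A(a) & \; f_\sigma(a)m_d+m_D b-m_\sigma D_B(b)+\xi(m)+D_A(1_A)m\\ & D_B(b)\end{pmatrix}$$ for all $a\in A$, $m\in M$, $b\in B$, where $m_d,m_D$ are elements of $M$, $D_A$ is a generalized $f_\sigma$-derivation of $A$ with associated $f_\sigma$-derivation $d_A$, and $D_B$ is a generalized $g_\sigma$-derivation of $B$ with associated $g_\sigma$-derivation $d_B$; in other words, $$D_A(aa')=D_A(a)a'+f_\sigma(a)d_A(a'),\qquad D_B(bb')=D_B(b)b'+g_\sigma(b)d_B(b')$$ for all $a,a'\in A$ and $b,b'\in B$.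
   Context: The triangular algebra $\mathrm{Trian}(A,M,B)$ is the set of all matrices $\begin{pmatrix} a & m\\ & b\end{pmatrix}$ with $a\in A$, $m\in M$, $b\in B$, which is a unital associative $R$-algebra under the usual matrix operations. All automorphisms are $R$-algebra automorphisms and linear means $R$-linear; $1_A,1_B$ are the units. An algebra has only trivial idempotents if $0$ and $1$ are its only idempotents. Data determined by $\sigma$ (known result): when $A$ and $B$ have only trivial idempotents, every automorphism $\sigma$ of $\mathcal{T}=\mathrm{Trian}(A,M,B)$ has the form $$\sigma\begin{pmatrix} a & m\\ & b\end{pmatrix}=\begin{pmatrix} f_\sigma(a) & f_\sigma(a)m_\sigma-m_\sigma g_\sigma(b)+\nu_\sigma(m)\\ & g_\sigma(b)\end{pmatrix},$$ where $f_\sigma$, $g_\sigma$ are automorphisms of $A$, $B$ respectively, $m_\sigma\in M$, and $\nu_\sigma:M\to M$ is a linear bijection with $\nu_\sigma(am)=f_\sigma(a)\nu_\sigma(m)$ and $\nu_\sigma(mb)=\nu_\sigma(m)g_\sigma(b)$ for all $a\in A$, $b\in B$, $m\in M$. For an automorphism $\varphi$ of an algebra $\mathcal{A}$, a $\varphi$-derivation of $\mathcal{A}$ is a linear map $d:\mathcal{A}\to\mathcal{A}$ with $d(xy)=d(x)y+\varphi(x)d(y)$ for all $x,y\in\mathcal{A}$. A generalized $\varphi$-derivation of $\mathcal{A}$ is a linear map $D:\mathcal{A}\to\mathcal{A}$ for which there exists a $\varphi$-derivation $d$ of $\mathcal{A}$ (called associated to $D$) with $D(xy)=D(x)y+\varphi(x)d(y)$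 for all $x,y\in\mathcal{A}$. *)

(* Defs.v *)
From HB Require Import structures.
From mathcomp Require Import all_boot all_algebra.

Set Implicit Arguments.
Unset Strict Implicit.
Unset Printing Implicit Defensive.

Import GRing.Theory.
Local Open Scope ring_scope.

Reserved Notation "a |*: m" (at level 40, left associativity).
Reserved Notation "m :*| b" (at level 40, left associativity).

(* The R-module structure of M is the one induced by either action:           *)
(* k *: m = k%:A |*: m = m :*| k%:A follows from the last four axioms.        *)
HB.mixin Record Lmodule_isBimodule (R : comPzRingType) (A B : algType R) M
    of GRing.Lmodule R M := {
  lact : A -> M -> M;
  ract : M -> B -> M;
  lactDl : forall a a' m, lact (a + a') m = lact a m + lact a' m;
  lactDr : forall a m m', lact a (m + m') = lact a m + lact a m';
  lactA : forall a a' m, lact (a * a') m = lact a (lact a' m);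
  ractDl : forall m m' b, ract (m + m') b = ract m b + ract m' b;
  ractDr : forall m b b', ract m (b + b') = ract m b + ract m b';
  ractA : forall m b b', ract m (b * b') = ract (ract m b) b';
  lractA : forall a m b, lact a (ract m b) = ract (lact a m) b;
  lact1 : forall m, lact 1 m = m;
  ract1 : forall m, ract m 1 = m;
  lactZl : forall k a m, lact (k *: a) m = k *: lact a m;
  ractZr : forall k m b, ract m (k *: b) = k *: ract m b
}.

#[short(type="bimodType")]
HB.structure Definition Bimodule (R : comPzRingType) (A B : algType R) :=
  {M of GRing.Lmodule R M & Lmodule_isBimodule R A B M}.

Notation "a |*: m" := (lact a m) : ring_scope.
Notation "m :*| b" := (ract m b) : ring_scope.

Section BimoduleTheory.
Variables (R : comPzRingType) (A B : algType R) (M : bimodType A B).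
Implicit Types (a : A) (b : B) (m : M) (k : R).

Definition left_faithful := forall a, (forall m, a |*: m = 0) -> a = 0.
Definition right_faithful := forall b, (forall m, m :*| b = 0) -> b = 0.

Lemma lact0r a : a |*: (0 : M) = 0.
Proof. by apply: (addrI (a |*: (0 : M))); rewrite -lactDr !addr0. Qed.
Lemma lact0l m : (0 : A) |*: m = 0.
Proof. by apply: (addrI ((0 : A) |*: m)); rewrite -lactDl !addr0. Qed.
Lemma ract0r m : m :*| (0 : B) = 0.
Proof. by apply: (addrI (m :*| (0 : B))); rewrite -ractDr !addr0. Qed.
Lemma ract0l b : (0 : M) :*| b = 0.
Proof. by apply: (addrI ((0 : M) :*| b)); rewrite -ractDl !addr0. Qed.
Lemma lactNr a m : a |*: (- m) = - (a |*: m).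
Proof. by apply: (addrI (a |*: m)); rewrite -lactDr !subrr lact0r. Qed.
Lemma ractNl m b : (- m) :*| b = - (m :*| b).
Proof. by apply: (addrI (m :*| b)); rewrite -ractDl !subrr ract0l. Qed.
Lemma lactZE k m : k *: m = k%:A |*: m.
Proof. by rewrite lactZl lact1. Qed.
Lemma ractZE k m : k *: m = m :*| k%:A.
Proof. by rewrite ractZr ract1. Qed.
Lemma lactZr k a m : a |*: (k *: m) = k *: (a |*: m).
Proof. by rewrite !ractZE lractA. Qed.
Lemma ractZl k m b : (k *: m) :*| b = k *: (m :*| b).
Proof. by rewrite !lactZE lractA. Qed.

End BimoduleTheory.

Arguments left_faithful {R A B} M.
Arguments right_faithful {R A B} M.

(* TrianMx a m b is the upper triangular matrix with diagonal entries a, b    *)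
(* and upper right entry m.                                                   *)
Record trian (R : comPzRingType) (A B : algType R) (M : bimodType A B) :=
  TrianMx { trA : A; trM : M; trB : B }.

Notation Trian A M B := (@trian _ A B M).

Section Triangular.
Variables (R : comPzRingType) (A B : algType R) (M : bimodType A B).
Local Notation T := (Trian A M B).
Implicit Types (x y z : T) (k : R).

Let to_prod x : A * M * B := (trA x, trM x, trB x).
Let of_prod (p : A * M * B) : T := TrianMx p.1.1 p.1.2 p.2.
Fact trian_prodK : cancel to_prod of_prod. Proof. by case. Qed.

HB.instance Definition _ := Choice.copy T (can_type trian_prodK).

Definition trian_zero : T := TrianMx 0 0 0.
Definition trian_opp x : T := TrianMx (- trA x) (- trM x) (- trB x).
Definition trian_add x y : T :=
  TrianMx (trA x + trA y) (trM x + trM y) (trB x + trB y).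
Definition trian_one : T := TrianMx 1 0 1.
Definition trian_mul x y : T :=
  TrianMx (trA x * trA y) (trA x |*: trM y + trM x :*| trB y) (trB x * trB y).
Definition trian_scale k x : T :=
  TrianMx (k *: trA x) (k *: trM x) (k *: trB x).

Fact trian_addA : associative trian_add.
Proof. by move=> x y z; congr TrianMx; apply: addrA. Qed.
Fact trian_addC : commutative trian_add.
Proof. by move=> x y; congr TrianMx; apply: addrC. Qed.
Fact trian_add0 : left_id trian_zero trian_add.
Proof. by case=> a m b; congr TrianMx; apply: add0r. Qed.
Fact trian_addN : left_inverse trian_zero trian_opp trian_add.
Proof. by move=> x; congr TrianMx; apply: addNr. Qed.

HB.instance Definition _ := GRing.isZmodule.Build T
  trian_addA trian_addC trian_add0 trian_addN.

Fact trian_mulA : associative trian_mul.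
Proof.
move=> x y z; congr TrianMx; rewrite /= ?mulrA //.
by rewrite lactDr ractDl lactA ractA lractA addrA.
Qed.
Fact trian_mul1l : left_id trian_one trian_mul.
Proof. by case=> a m b; congr TrianMx; rewrite /= ?mul1r // lact1 ract0l addr0. Qed.
Fact trian_mul1r : right_id trian_one trian_mul.
Proof. by case=> a m b; congr TrianMx; rewrite /= ?mulr1 // ract1 lact0r add0r. Qed.
Fact trian_mulDl : left_distributive trian_mul trian_add.
Proof.
move=> x y z; congr TrianMx; rewrite /= ?mulrDl //.
by rewrite lactDl ractDl addrACA.
Qed.
Fact trian_mulDr : right_distributive trian_mul trian_add.
Proof.
move=> x y z; congr TrianMx; rewrite /= ?mulrDr //.
by rewrite lactDr ractDr addrACA.
Qed.
Fact trian_oner_neq0 : trian_one != 0.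
Proof. by apply/eqP => -[/eqP]; rewrite oner_eq0. Qed.

HB.instance Definition _ := GRing.Zmodule_isNzRing.Build T
  trian_mulA trian_mul1l trian_mul1r trian_mulDl trian_mulDr trian_oner_neq0.

Fact trian_scaleA k l x :
  trian_scale k (trian_scale l x) = trian_scale (k * l) x.
Proof. by congr TrianMx; apply: scalerA. Qed.
Fact trian_scale1 : left_id 1 trian_scale.
Proof. by case=> a m b; congr TrianMx; apply: scale1r. Qed.
Fact trian_scaleDr : right_distributive trian_scale +%R.
Proof. by move=> k x y; congr TrianMx; apply: scalerDr. Qed.
Fact trian_scaleDl x : {morph trian_scale^~ x : k l / k + l}.
Proof. by move=> k l; congr TrianMx; apply: scalerDl. Qed.

HB.instance Definition _ := GRing.Zmodule_isLmodule.Build R T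
  trian_scaleA trian_scale1 trian_scaleDr trian_scaleDl.

Fact trian_scaleAl k x y : k *: (x * y) = (k *: x) * y.
Proof.
congr TrianMx; rewrite /= ?scalerAl //.
by rewrite lactZl ractZl scalerDr.
Qed.

HB.instance Definition _ := GRing.Lmodule_isLalgebra.Build R T trian_scaleAl.

Fact trian_scaleAr k x y : k *: (x * y) = x * (k *: y).
Proof.
congr TrianMx; rewrite /= ?scalerAr //.
by rewrite lactZr ractZr scalerDr.
Qed.

HB.instance Definition _ := GRing.Lalgebra_isAlgebra.Build R T trian_scaleAr.

End Triangular.

Definition only_trivial_idempotents (S : nzRingType) :=
  forall e : S, e * e = e -> e = 0 \/ e = 1.

Section Derivations.
Variables (R : comPzRingType) (S : algType R).
Implicit Types (phi : {lrmorphism S -> S}) (d D : {linear S -> S}).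

Definition automorphism phi := bijective phi.

Definition phi_derivation phi d :=
  forall x y, d (x * y) = d x * y + phi x * d y.

Definition generalized_with phi d D :=
  phi_derivation phi d /\ forall x y, D (x * y) = D x * y + phi x * d y.

Definition generalized_phi_derivation phi D := exists d, generalized_with phi d D.

End Derivations.

Section AutomorphismData.
Variables (R : comPzRingType) (A B : algType R) (M : bimodType A B).
Implicit Types (sigma : {lrmorphism Trian A M B -> Trian A M B}).
Implicit Types (f : {lrmorphism A -> A}) (g : {lrmorphism B -> B}).
Implicit Types (ms : M) (nu : {linear M -> M}).

Record aut_data sigma f g ms nu : Prop := AutData {
  aut_dataA : automorphism f;
  aut_dataB : automorphism g;
  aut_dataM : bijective nu;
  aut_data_lact : forall (a : A) (m : M), nu (a |*: m) = f a |*: nu m;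
  aut_data_ract : forall (m : M) (b : B), nu (m :*| b) = nu m :*| g b;
  aut_dataE : forall (a : A) (m : M) (b : B),
    sigma (TrianMx a m b) = TrianMx (f a) (f a |*: ms - ms :*| g b + nu m) (g b)
}.

Lemma aut_data_unique sigma f g ms nu f' g' ms' nu' :
    aut_data sigma f g ms nu -> aut_data sigma f' g' ms' nu' ->
  [/\ f =1 f', g =1 g', ms = ms' & nu =1 nu'].
Proof.
move=> [_ _ _ _ _ E] [_ _ _ _ _ E'].
have eqE a m b := etrans (esym (E a m b)) (E' a m b).
split=> [a|b||m]; first by case: (eqE a 0 0).
- by case: (eqE 0 0 b).
- case: (eqE 1 0 0) => _.
  by rewrite !rmorph1 !lact1 !rmorph0 !ract0r !linear0 !addr0.
- case: (eqE 0 m 0) => _.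
  by rewrite !rmorph0 !lact0l !ract0r !subrr !add0r.
Qed.

Local Notation simp := (mulr0, mul0r, mulr1, mul1r, lact0l, lact0r, ract0l,
  ract0r, lact1, ract1, oppr0, addr0, add0r, subr0, sub0r, lactNr, ractNl).

(* Hence, under the hypotheses below, quantifying over all f, g, ms, nu with  *)
(* aut_data sigma f g ms nu is neither vacuous nor ambiguous.                 *)
Lemma aut_data_exists sigma :
    (exists m : M, m <> 0) ->
    only_trivial_idempotents A -> only_trivial_idempotents B ->
    automorphism sigma ->
  exists f g ms nu, aut_data sigma f g ms nu.
Proof.
move=> [m0 m0_neq0] idA idB bij_sigma.
have sigmaI := bij_inj bij_sigma.
pose e : Trian A M B := TrianMx 1 0 0.
pose mxM m : Trian A M B := TrianMx 0 m 0.
have trianP (x : Trian A M B) : x = TrianMx (trA x) (trM x) (trB x) by case: x.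
have mulE a m b a' m' b' : (TrianMx a m b : Trian A M B) * TrianMx a' m' b' =
  TrianMx (a * a') (a |*: m' + m :*| b') (b * b') by [].
have subE a m b a' m' b' : (TrianMx a m b : Trian A M B) - TrianMx a' m' b' =
  TrianMx (a - a') (m - m') (b - b') by [].
have oneE : 1 = (TrianMx 1 0 1 : Trian A M B) by [].
have zeroE : 0 = (TrianMx 0 0 0 : Trian A M B) by [].
have e'E : 1 - e = TrianMx 0 0 1 by congr TrianMx; rewrite /= ?subrr ?subr0.
have ee : e * e = e by rewrite mulE !simp.
have eM m : mxM m = e * mxM m * (1 - e) by rewrite e'E !mulE !simp.
pose p := sigma e.
have pp : p * p = p by rewrite -rmorphM ee.
have [ms pE] : exists ms, p = TrianMx 1 ms 0.
  have p_neq0 : p <> 0.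
    move=> p0; have /sigmaI[] : sigma e = sigma 0 by rewrite rmorph0.
    by move/eqP; rewrite oner_eq0.
  have p_neq1 : p <> 1.
    move=> p1; have /sigmaI[] : sigma e = sigma 1 by rewrite rmorph1.
    by move/eqP; rewrite eq_sym oner_eq0.
  have pMp : p * sigma (mxM m0) * (1 - p) <> 0.
    rewrite -(rmorph1 sigma) -rmorphB -!rmorphM -eM -(rmorph0 sigma).
    by move=> /sigmaI[].
  move: pp p_neq0 p_neq1 pMp; rewrite (trianP p) (trianP (sigma _)).
  move: (trA p) (trM p) (trB p) => a m b; rewrite mulE => -[aa am bb].
  case: (idA _ aa) am => ->; case: (idB _ bb) => ->; rewrite !simp.
  - by move=> <- [].
  - by move=> _ _ _ []; rewrite oneE subE !mulE !simp subrr !simp.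
  - by move=> _ _ _ _; exists m.
  - move=> mm _ []; congr TrianMx.
    by apply: (addrI m); rewrite addr0.
have p'E : 1 - p = TrianMx 0 (- ms) 1.
  by rewrite pE oneE subE subrr !simp.
pose fF a := trA (sigma (TrianMx a 0 0)).
pose gF b := trB (sigma (TrianMx 0 0 b)).
pose nF m := trM (sigma (mxM m)).
have p_p x : p * x * p = TrianMx (trA x) (trA x |*: ms) 0.
  by case: x => a m b; rewrite pE !mulE !simp.
have p_p' x : p * x * (1 - p) =
    TrianMx 0 (trM x + ms :*| trB x - trA x |*: ms) 0.
  by case: x => a m b; rewrite p'E pE !mulE !simp /= addrC.
have p'_p' x : (1 - p) * x * (1 - p) = TrianMx 0 (- (ms :*| trB x)) (trB x).
  by case: x => a m b; rewrite p'E !mulE !simp.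
have sA a : sigma (TrianMx a 0 0) = TrianMx (fF a) (fF a |*: ms) 0.
  by rewrite -p_p -!rmorphM !mulE !simp.
have sB b : sigma (TrianMx 0 0 b) = TrianMx 0 (- (ms :*| gF b)) (gF b).
  by rewrite -p'_p' -(rmorph1 sigma) -rmorphB -!rmorphM e'E !mulE !simp.
have sM m : sigma (mxM m) = mxM (nF m).
  have : sigma (mxM m) = p * sigma (mxM m) * (1 - p).
    by rewrite -(rmorph1 sigma) -rmorphB -!rmorphM -eM.
  by rewrite p_p' /nF => ->.
have addE a m b a' m' b' : (TrianMx a m b : Trian A M B) + TrianMx a' m' b' =
  TrianMx (a + a') (m + m') (b + b') by [].
have scaleE k a m b : k *: (TrianMx a m b : Trian A M B) =
  TrianMx (k *: a) (k *: m) (k *: b) by [].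
have f_lin : linear fF.
  move=> k a a'; rewrite /fF.
  have -> : (TrianMx (k *: a + a') 0 0 : Trian A M B) =
    k *: TrianMx a 0 0 + TrianMx a' 0 0 by rewrite scaleE addE !scaler0 !simp.
  by rewrite linearP.
have g_lin : linear gF.
  move=> k b b'; rewrite /gF.
  have -> : (TrianMx 0 0 (k *: b + b') : Trian A M B) =
    k *: TrianMx 0 0 b + TrianMx 0 0 b' by rewrite scaleE addE !scaler0 !simp.
  by rewrite linearP.
have n_lin : linear nF.
  move=> k m m'; rewrite /nF.
  have -> : mxM (k *: m + m') = k *: mxM m + mxM m'.
    by rewrite scaleE addE !scaler0 !simp.
  by rewrite linearP.
have f_mul : monoid_morphism fF.
  split=> [|a a']; first by rewrite /fF -/e -/p pE.
  rewrite /fF.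
  have -> : (TrianMx (a * a') 0 0 : Trian A M B) =
    TrianMx a 0 0 * TrianMx a' 0 0 by rewrite mulE !simp.
  by rewrite rmorphM.
have g_mul : monoid_morphism gF.
  split=> [|b b']; rewrite /gF.
    by rewrite -e'E rmorphB rmorph1 -/p p'E.
  have -> : (TrianMx 0 0 (b * b') : Trian A M B) =
    TrianMx 0 0 b * TrianMx 0 0 b' by rewrite mulE !simp.
  by rewrite rmorphM.
pose fL := GRing.isLinear.Build R A A *:%R fF f_lin.
pose fR := GRing.isMonoidMorphism.Build A A fF f_mul.
pose gL := GRing.isLinear.Build R B B *:%R gF g_lin.
pose gR := GRing.isMonoidMorphism.Build B B gF g_mul.
pose nL := GRing.isLinear.Build R M M *:%R nF n_lin.
pose f : {lrmorphism A -> A} := HB.pack fF fL fR.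
pose g : {lrmorphism B -> B} := HB.pack gF gL gR.
pose nu : {linear M -> M} := HB.pack nF nL.
have sE a m b : sigma (TrianMx a m b) =
    TrianMx (f a) (f a |*: ms - ms :*| g b + nu m) (g b).
  have -> : (TrianMx a m b : Trian A M B) =
    TrianMx a 0 0 + TrianMx 0 0 b + mxM m by rewrite !addE !simp.
  by rewrite !linearD /= sA sB sM !addE !simp.
have [tau sigmaK tauK] := bij_sigma.
exists f, g, ms, nu; split=> //.
- exists (fun a => trA (tau (TrianMx a (a |*: ms) 0))) => a.
    by rewrite -[TrianMx _ _ _](sA a) sigmaK.
  have := tauK (TrianMx a (a |*: ms) 0).
  by rewrite [tau _]trianP sE => -[].
- exists (fun b => trB (tau (TrianMx 0 (- (ms :*| b)) b))) => b.
    by rewrite -[TrianMx _ _ _](sB b) sigmaK.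
  have := tauK (TrianMx 0 (- (ms :*| b)) b).
  by rewrite [tau _]trianP sE => -[].
- exists (fun m => trM (tau (mxM m))) => m.
    by rewrite -[mxM _](sM m) sigmaK.
  have := tauK (mxM m).
  by rewrite [tau _]trianP sE => -[-> + gb0]; rewrite [X in _ :*| X]gb0 !simp.
- move=> a m; suff [] : mxM (nF (a |*: m)) = TrianMx 0 (fF a |*: nF m) 0 by [].
  rewrite -sM (_ : mxM _ = TrianMx a 0 0 * mxM m); last by rewrite mulE !simp.
  by rewrite rmorphM /= sA sM mulE !simp.
- move=> m b; suff [] : mxM (nF (m :*| b)) = TrianMx 0 (nF m :*| gF b) 0 by [].
  rewrite -sM (_ : mxM _ = mxM m * TrianMx 0 0 b); last by rewrite mulE !simp.
  by rewrite rmorphM /= sB sM mulE !simp.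
Qed.

End AutomorphismData.

(* Main.v *)
(* Since D(x) = D(1)x + d(x), everything reduces to the sigma-derivation d.   *)
(* Evaluating d on products with e = diag(1,0) or 1 - e gives                 *)
(* d(e) = (0 m_d; 0) and then determines d on each corner of the algebra.     *)
Require Import Defs.
From HB Require Import structures.
From mathcomp Require Import all_boot all_algebra.

Set Implicit Arguments.
Unset Strict Implicit.
Unset Printing Implicit Defensive.

Import GRing.Theory.
Local Open Scope ring_scope.

(** Because [sigma] sends [e] to a matrix with diagonal (1, 0), comparing entries in
    [d e = d e * e + sigma e * d e] kills the diagonal of [d e]. Each corner absorbs [e] or [1 - e]
    as a factor, so the twisted Leibniz rule fixes the entries of [d] outside that corner; the
    remaining freedom is [dA], [xi], [dB]. Their identities are the corners of [d] on products of
    corner elements ([trian_phi_derivation]). Adding left multiplication by [D 1] turns [dA] and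
    [dB] into generalized derivations with the same associated derivations
    ([generalized_with_mulD]), and the off-diagonal terms regroup. *)

Section DerivationTheory.
Variables (R : comPzRingType) (S : algType R).
Implicit Types (phi : {lrmorphism S -> S}) (d D : {linear S -> S}).

Lemma phi_derivation1 phi d : phi_derivation phi d -> d 1 = 0.
Proof.
move=> dM; apply: (addrI (d 1)).
by rewrite addr0 -[RHS](congr1 d (mulr1 1)) dM rmorph1 mulr1 mul1r.
Qed.

(** Expand [D (1 * x)] and use [phi 1 = 1]. *)
Lemma generalized_withE phi d D :
  generalized_with phi d D -> forall x, D x = D 1 * x + d x.
Proof. by case=> _ DM x; rewrite -{1}[x]mul1r DM rmorph1 mul1r. Qed.

(** A converse to [generalized_withE]: the term [c * x * y] is absorbed by the first summand of the
    Leibniz rule. *)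
Lemma generalized_with_mulD phi d (c : S) :
  phi_derivation phi d -> generalized_with phi d ((c \*o idfun) \+ d).
Proof. by move=> dM; split=> // x y; rewrite /= dM mulrDl mulrA addrA. Qed.

End DerivationTheory.

Section TriangularMaps.
Variables (R : comPzRingType) (A B : algType R) (M : bimodType A B).
Local Notation T := (Trian A M B).

Definition inA (a : A) : T := TrianMx a 0 0.
Definition inM (m : M) : T := TrianMx 0 m 0.
Definition inB (b : B) : T := TrianMx 0 0 b.

Lemma inAE a : inA a = TrianMx a 0 0. Proof. by []. Qed.
Lemma inME m : inM m = TrianMx 0 m 0. Proof. by []. Qed.
Lemma inBE b : inB b = TrianMx 0 0 b. Proof. by []. Qed.

Fact trA_linear : linear (fun x : T => trA x). Proof. by []. Qed.
Fact trM_linear : linear (fun x : T => trM x). Proof. by []. Qed.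
Fact trB_linear : linear (fun x : T => trB x). Proof. by []. Qed.
Fact inA_linear : linear inA.
Proof. by move=> k a a'; congr TrianMx; rewrite /= !scaler0 addr0. Qed.
Fact inM_linear : linear inM.
Proof. by move=> k m m'; congr TrianMx; rewrite /= !scaler0 addr0. Qed.
Fact inB_linear : linear inB.
Proof. by move=> k b b'; congr TrianMx; rewrite /= !scaler0 addr0. Qed.

(** With projections and corner embeddings linear, compressing [d] to a corner yields bundled linear
    maps directly. *)
HB.instance Definition _ :=
  GRing.isLinear.Build R T A *:%R (@trA R A B M) trA_linear.
HB.instance Definition _ :=
  GRing.isLinear.Build R T M *:%R (@trM R A B M) trM_linear.
HB.instance Definition _ :=
  GRing.isLinear.Build R T B *:%R (@trB R A B M) trB_linear.
HB.instance Definition _ := GRing.isLinear.Build R A T *:%R inA inA_linear.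
HB.instance Definition _ := GRing.isLinear.Build R M T *:%R inM inM_linear.
HB.instance Definition _ := GRing.isLinear.Build R B T *:%R inB inB_linear.

Lemma trian_mulE a m b a' m' b' : (TrianMx a m b : T) * TrianMx a' m' b' =
  TrianMx (a * a') (a |*: m' + m :*| b') (b * b').
Proof. by []. Qed.

Lemma trian_addE a m b a' m' b' : (TrianMx a m b : T) + TrianMx a' m' b' =
  TrianMx (a + a') (m + m') (b + b').
Proof. by []. Qed.

Lemma trian_sum a m b : TrianMx a m b = inA a + inM m + inB b :> T.
Proof. by rewrite !trian_addE !addr0 !add0r. Qed.

End TriangularMaps.

Section TriangularDerivation.
Variables (R : comPzRingType) (A B : algType R) (M : bimodType A B).
Local Notation T := (Trian A M B).
Variables (sigma : {lrmorphism T -> T}) (f : {lrmorphism A -> A}).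
Variables (g : {lrmorphism B -> B}) (ms : M) (nu : {linear M -> M}).
Hypothesis sigma_data : aut_data sigma f g ms nu.
Variable d : {linear T -> T}.
Hypothesis dM : phi_derivation sigma d.

Local Notation simp := (mulr0, mul0r, mulr1, mul1r, lact0l, lact0r, ract0l,
  ract0r, lact1, ract1, oppr0, addr0, add0r, subr0, sub0r, lactNr, ractNl,
  inAE, inME, inBE, trian_mulE, trian_addE).

Local Notation e := (inA M 1).
Let md : M := trM (d e).
Let dA : {linear A -> A} := @trA R A B M \o d \o @inA R A B M.
Let dB : {linear B -> B} := @trB R A B M \o d \o @inB R A B M.
Let xi : {linear M -> M} := @trM R A B M \o d \o @inM R A B M.

Let sigma_inA a : sigma (inA M a) = TrianMx (f a) (f a |*: ms) 0.
Proof. by rewrite (aut_dataE sigma_data) !linear0 !simp. Qed.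

Let sigma_inM m : sigma (inM m) = inM (nu m).
Proof. by rewrite (aut_dataE sigma_data) !linear0 !simp. Qed.

Let sigma_inB b : sigma (inB M b) = TrianMx 0 (- (ms :*| g b)) (g b).
Proof. by rewrite (aut_dataE sigma_data) !linear0 !simp. Qed.

Let d_e : d e = inM md.
Proof.
have : e = e * e by rewrite !simp.
move/(congr1 d); rewrite dM sigma_inA rmorph1 /md.
case: (d e) => a m b; rewrite !simp => -[a0 _ ->]; congr TrianMx.
by apply: (addrI a); rewrite addr0.
Qed.

Let inB1 : inB M 1 = 1 - e.
Proof. by congr TrianMx; rewrite /= ?subrr ?subr0. Qed.

Let d_inB1 : d (inB M 1) = inM (- md).
Proof. by rewrite inB1 linearB /= (phi_derivation1 dM) sub0r d_e linearN. Qed.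

Let d_inA a : d (inA M a) = TrianMx (dA a) (f a |*: md) 0.
Proof.
have : inA M a = inA M a * e by rewrite !simp.
move/(congr1 d); rewrite dM d_e sigma_inA /dA /=.
by case: (d (inA M a)) => a' m b; rewrite !simp => -[-> ->].
Qed.

(** The left factor [e] kills the [B] entry and the right factor [1 - e] kills the [A] entry. *)
Let d_inM m : d (inM m) = inM (xi m).
Proof.
have : inM m = e * inM m by rewrite !simp.
move/(congr1 d); rewrite dM d_e sigma_inA rmorph1.
have : inM m = inM m * inB M 1 by rewrite !simp.
move/(congr1 d); rewrite dM d_inB1 sigma_inM /xi /=.
by case: (d (inM m)) => a m' b; rewrite !simp => -[->] [_ ->].
Qed.

(** The term in [ms] comes from [sigma (1 - e)], whose off-diagonal entry is [- ms]. *)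
Let d_inB b :
  d (inB M b) = TrianMx 0 (- (md :*| b) - ms :*| dB b) (dB b).
Proof.
have : inB M b = inB M 1 * inB M b by rewrite !simp.
move/(congr1 d); rewrite dM d_inB1 sigma_inB rmorph1 /dB /=.
by case: (d (inB M b)) => a m b'; rewrite !simp => -[-> ->].
Qed.

Lemma trian_phi_derivation :
  exists (d_A : {linear A -> A}) (d_B : {linear B -> B}) (x : {linear M -> M}),
    [/\ phi_derivation f d_A,
        phi_derivation g d_B,
        forall a m, x (a |*: m) = d_A a |*: m + f a |*: x m,
        forall m b, x (m :*| b) = x m :*| b + nu m :*| d_B b &
        exists m_d : M, forall a m b,
          d (TrianMx a m b) =
          TrianMx (d_A a) (f a |*: m_d - m_d :*| b - ms :*| d_B b + x m)
            (d_B b)].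
Proof.
exists dA, dB, xi; split=> [a a'|b b'|a m|m b|].
- have : inA M (a * a') = inA M a * inA M a' by rewrite !simp.
  by move/(congr1 d); rewrite dM sigma_inA !d_inA !simp => -[].
- have : inB M (b * b') = inB M b * inB M b' by rewrite !simp.
  by move/(congr1 d); rewrite dM sigma_inB !d_inB !simp => -[].
- have : inM (a |*: m) = inA M a * inM m by rewrite !simp.
  by move/(congr1 d); rewrite dM sigma_inA d_inA !d_inM !simp => -[].
- have : inM (m :*| b) = inM m * inB M b by rewrite !simp.
  by move/(congr1 d); rewrite dM sigma_inM d_inB !d_inM !simp => -[].
- exists md => a m b; rewrite trian_sum !linearD d_inA d_inM d_inB !simp.
  by congr TrianMx; rewrite addrAC !addrA.
Qed.

End TriangularDerivation.

Theorem theorem4p2 (R : comPzRingType) (A B : algType R) (M : bimodType A B)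
    (M_neq0 : exists m : M, m <> 0)
    (M_left_faithful : left_faithful M)
    (M_right_faithful : right_faithful M)
    (idemA : only_trivial_idempotents A)
    (idemB : only_trivial_idempotents B)
    (sigma : {lrmorphism Trian A M B -> Trian A M B})
    (sigma_aut : automorphism sigma)
    (f_s : {lrmorphism A -> A}) (g_s : {lrmorphism B -> B})
    (m_s : M) (nu_s : {linear M -> M})
    (sigma_data : aut_data sigma f_s g_s m_s nu_s)
    (D : {linear Trian A M B -> Trian A M B})
    (D_gen : generalized_phi_derivation sigma D) :
  exists (d_A : {linear A -> A}) (d_B : {linear B -> B}) (xi : {linear M -> M}),
    [/\ phi_derivation f_s d_A,
        phi_derivation g_s d_B,
        forall (a : A) (m : M), xi (a |*: m) = d_A a |*: m + f_s a |*: xi m,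
        forall (m : M) (b : B), xi (m :*| b) = xi m :*| b + nu_s m :*| d_B b &
        exists (m_d m_D : M) (D_A : {linear A -> A}) (D_B : {linear B -> B}),
          [/\ generalized_with f_s d_A D_A,
              generalized_with g_s d_B D_B &
              forall (a : A) (m : M) (b : B),
                D (TrianMx a m b) =
                TrianMx (D_A a)
                  (f_s a |*: m_d + m_D :*| b - m_s :*| D_B b + xi m
                   + D_A 1 |*: m)
                  (D_B b)]].
Proof.
have [d Dd] := D_gen; have [dM _] := Dd.
have [d_A [d_B [xi [dAM dBM xil xir [m_d dE]]]]] :=
  trian_phi_derivation sigma_data dM.
exists d_A, d_B, xi; split=> //.
case D1E: (D 1) => [c m c'].
(* [m - m_d] collects the coefficients of [b] coming from [D 1] and [d]; [m_s :*| c'] compensates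
   for writing [D_B b] in place of [d_B b]. *)
exists m_d, (m - m_d + m_s :*| c').
exists ((c \*o idfun) \+ d_A), ((c' \*o idfun) \+ d_B).
split; [exact: generalized_with_mulD..|] => a n b.
rewrite (generalized_withE Dd) D1E dE trian_mulE trian_addE.
(* Since [d_A 1 = 0], the value of [D_A] at 1 is [c]. *)
congr TrianMx; rewrite /= (phi_derivation1 dAM) mulr1 addr0.
rewrite !ractDl ractNl ractDr ractA.
(* The added term [m_s c' b] of [m_D b] cancels the one in [- m_s D_B(b)]. *)
rewrite -[X in _ = X + _ + _]addrA opprD (addrA _ (- (_ :*| _ :*| _))) addrK.
by rewrite [LHS](AC (2*4) ((3*((2*4)*5))*6*1)).
Qed.
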